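(* Let $\alpha\in\mathbb{R}$, $b\in\mathbb{N}$, $b\ge2$. There is a constant $C=C(\alpha,b)>0$ such that for all $x\in\mathbb{R}$ the oscillatory integral $$I^{b,\alpha}(x)=\int_{\mathbb{R}}e^{i(\xi^b+x\xi)}|\xi|^\alpha\,d\xi$$ satisfies $$|I^{b,\alpha}(x)|\le C\begin{cases}(1+|x|)^{-1-\alpha}, & \text{if } -1<\alpha\le-\tfrac12,\\[2pt] (1+|x|)^{\frac1{b-1}\left(\alpha-\frac b2+1\right)}, & \text{if } -\tfrac12<\alpha<b-1.\end{cases}$$
   Context: The integral over $\mathbb{R}$ is understood as an (in general conditionally convergent) improper integral, i.e. as the limit of the integrals over $[-R_1,R_2]$ as $R_1,R_2\to\infty$; it converges for $-1<\alpha<b-1$. *)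

(* Defs.v *)
From HB Require Import structures.
From mathcomp Require Import all_boot all_order all_algebra complex.
From mathcomp Require Import all_classical all_reals all_analysis.

Set Implicit Arguments.
Unset Strict Implicit.
Unset Printing Implicit Defensive.

Import Order.TTheory GRing.Theory Num.Theory.
Import numFieldNormedType.Exports.

Local Open Scope classical_set_scope.
Local Open Scope complex_scope.
Local Open Scope ring_scope.

Definition expi (R : realType) (t : R) : R[i] := cos t +i* sin t.

Definition Cintegral (R : realType) (D : set R) (f : R -> R[i]) : R[i] :=
  Rintegral lebesgue_measure D (fun t => complex.Re (f t)) +i*
  Rintegral lebesgue_measure D (fun t => complex.Im (f t)).

(* The norm topology is only inferred on a carrier of the form
   [Num.NumField.sort K], which [R[i]] is not syntactically. *)
Definition Cplx (R : realType) : numFieldType := R[i].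

Definition truncated_integral (R : realType) (f : R -> R[i]) (r : R * R) :
  Cplx R := Cintegral `[- r.1, r.2] f.

(* The two truncation bounds tend to [+oo] independently of each other. *)
Definition improper_cvg (R : realType) (f : R -> R[i]) : Prop :=
  cvg (truncated_integral f r @[r --> (+oo, +oo)]).

(* Meaningful only under [improper_cvg f]: otherwise [lim] is a default value. *)
Definition improper_integral (R : realType) (f : R -> R[i]) : R[i] :=
  lim (truncated_integral f r @[r --> (+oo, +oo)]).

(* At [xi = 0] the library sets [0 `^ alpha] to [1] or [0]; as this concerns a
   single point, it has no influence on the integrals. *)
Definition osc_integrand (R : realType) (b : nat) (alpha x xi : R) : R[i] :=
  expi (xi ^+ b + x * xi) * (`|xi| `^ alpha)%:C.

Definition osc_integral (R : realType) (b : nat) (alpha x : R) : R[i] :=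
  improper_integral (osc_integrand b alpha x).

(* Main.v *)
Require Import Defs.
From HB Require Import structures.
From mathcomp Require Import all_boot all_order all_algebra complex.
From mathcomp Require Import all_classical all_reals all_analysis.
From mathcomp Require Import measurable_realfun ring lra.

Import Order.TTheory GRing.Theory Num.Theory.
Import numFieldNormedType.Exports.

(** The line is cut at the origin and the negative half is reflected; the real
    and imaginary parts then become integrals over a half line of
    [cos (t ^+ b + x * t + th) * t `^ a] with a constant phase [th], and it
    suffices to control their primitives [F], for which only two facts matter:
    the derivative at every [t > 0] and the trivial bound
    [`|F t| <= t `^ (1 + a) / (1 + a)] ([half_line_le]).

    Write [b = n.+2], [m = max 1 |x|], [r = m `^ (1 / n.+1)], [lam = r ^+ b].
    The function [s |-> r `^ (- (1 + a)) * F (r * s)] is a primitive of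
    [cos (lam * (s ^+ b + y * s) + th) * s `^ a] with [y = x / m], so that
    either [lam = 1] (when [|x| <= 1]) or [y] is [1] or [-1].  The claim becomes
    a bound by a multiple of [lam `^ (-1 - a')] with [a' = min a (-1/2)]
    ([scaled_le]): the neighbourhood of the singularity at [0] contributes
    [lam `^ (-1 - a)], the stationary point contributes [lam `^ (-1/2)], and the
    larger of the two wins, which is where the two cases of the statement come
    from.

    Let [slope s = b * s ^+ n.+1 + y] be the derivative of [s ^+ b + y * s].
    Away from its zeros one integrates by parts: with
    [g = s `^ a / (lam * slope s)], the function [f - g * sin phase] has
    derivative [- g' * sin phase], hence any [G] with [`|g'| <= G'] gives
    [`|f v - f u| <= `|g u| + `|g v| + (G v - G u)] ([nonstationary_le]).  The
    following choices of [G] cover the half line: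
    - on [s >= 1] ([tail_le]), [slope s >= s ^+ n.+1] and [G] is a multiple of
      [s `^ (a - n.+1)], which tends to [0] because [a < b - 1]; this also gives
      the convergence of the improper integral;
    - on the part of [1/lam <= s <= 1] where [|slope| >= 1/2] ([head_le]), [G]
      is a multiple of [s `^ a'], the remaining piece [s <= 1/lam] being covered
      by the trivial bound;
    - for [y = -1] and [s] between half the stationary point [s0] and [2]
      ([near_stationary_le]), [|slope s| >= |s - s0|] and [G] is a multiple of
      [1 / (s - s0)]; the window [|s - s0| < lam `^ (-1/2)] is left out and
      estimated by its length ([stationary_le]). *)

Set Implicit Arguments.
Unset Strict Implicit.
Unset Printing Implicit Defensive.

Local Open Scope classical_set_scope.
Local Open Scope complex_scope.
Local Open Scope ring_scope.

(** * Integration by parts against a monotone majorant *)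

(** Comparing derivatives instead of integrating them: an estimate of
    [`|f'|] by a function with an explicit primitive [G] needs no integrability
    of [f']. *)
Lemma increment_le (R : realType) (f df G dG : R -> R) (u v : R) : u <= v ->
  (forall t, u <= t <= v -> is_derive t 1 f (df t)) ->
  (forall t, u <= t <= v -> is_derive t 1 G (dG t)) ->
  (forall t, u <= t <= v -> `|df t| <= dG t) ->
  `|f v - f u| <= G v - G u.
Proof.
move=> uv Df DG le_df.
have mono (h dh : R -> R) : (forall t, u <= t <= v -> is_derive t 1 h (dh t)) ->
    (forall t, u <= t <= v -> 0 <= dh t) -> h u <= h v.
  move=> Dh dh0.
  have ch : {within `[u, v], continuous h}.
    apply: derivable_within_continuous => t.
    by rewrite in_itv /= => /Dh [].
  have Dh_oo t : t \in `]u, v[ -> is_derive t 1 h (dh t).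
    by rewrite in_itv /= => /andP[/ltW ut /ltW tv]; apply: Dh; rewrite ut tv.
  have [c] := MVT_segment uv Dh_oo ch.
  rewrite in_itv /= => ucv hE; rewrite -subr_ge0 hE mulr_ge0 ?subr_ge0 //.
  exact: dh0.
have le1 : G u - f u <= G v - f v.
  apply: (mono (fun t => G t - f t) (fun t => dG t - df t)) => t tuv.
    by have ? := DG t tuv; have ? := Df t tuv; exact: is_deriveB.
  by have := le_df t tuv; rewrite ler_norml subr_ge0 => /andP[].
have le2 : G u + f u <= G v + f v.
  apply: (mono (fun t => G t + f t) (fun t => dG t + df t)) => t tuv.
    by have ? := DG t tuv; have ? := Df t tuv; exact: is_deriveD.
  by have := le_df t tuv; rewrite ler_norml => /andP[? _]; lra.
by rewrite ler_norml; apply/andP; split; lra.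
Qed.

(** [f - g * sin P] has derivative [- g' * sin P], because the term
    [g * P' * cos P] cancels against [f'].  This is integration by parts, with
    the remaining integral of [`|g'|] replaced by the increment of [G]. *)
Lemma nonstationary_le (R : realType) (f P dP g dg G dG : R -> R) (u v : R) :
  u <= v ->
  (forall t, u <= t <= v -> is_derive t 1 f (cos (P t) * (g t * dP t))) ->
  (forall t, u <= t <= v -> is_derive t 1 P (dP t)) ->
  (forall t, u <= t <= v -> is_derive t 1 g (dg t)) ->
  (forall t, u <= t <= v -> is_derive t 1 G (dG t)) ->
  (forall t, u <= t <= v -> `|dg t| <= dG t) ->
  `|f v - f u| <= `|g u| + `|g v| + (G v - G u).
Proof.
move=> uv Df DP Dg DG le_dg.
pose h t := f t - g t * sin (P t).
have : `|h v - h u| <= G v - G u.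
  apply: (@increment_le _ h (fun t => - (dg t * sin (P t)))) => // t tuv.
    have ? := DP t tuv; have ? := Df t tuv; have ? := Dg t tuv.
    have Ds : is_derive t 1 (sin \o P) (cos (P t) * dP t).
      exact: is_derive1_comp.
    apply: (@is_derive_eq _ _ _ (f - g * (sin \o P))).
    rewrite /GRing.scale /= /GRing.scale /=; ring.
  rewrite normrN normrM (le_trans _ (le_dg t tuv)) //.
  by rewrite ler_piMr // ler_norml sin_geN1 sin_le1.
have gs w : `|g w * sin (P w)| <= `|g w|.
  by rewrite normrM ler_piMr // ler_norml sin_geN1 sin_le1.
have := gs u; have := gs v; rewrite /h.
have -> : f v - f u = f v - g v * sin (P v) - (f u - g u * sin (P u))
   + g v * sin (P v) - g u * sin (P u) by ring.
move=> *; apply: le_trans (ler_normB _ _) _.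
have := ler_normD (f v - g v * sin (P v) - (f u - g u * sin (P u))) (g v * sin
  (P v)).
lra.
Qed.

(** * Increments of a primitive of the oscillating function *)

Definition slope (R : realType) (n : nat) (y s : R) : R :=
  n.+2%:R * s ^+ n.+1 + y.

(** The scaled half-line integral enters the estimates only through this
    differential equation, so that rescaling it is a chain rule and not a change
    of variables in an integral. *)
Definition osc_primitive (R : realType) (n : nat) (a lam y th : R)
    (f : R -> R) : Prop :=
  forall s : R, 0 < s ->
    is_derive s 1 f (cos (lam * (s ^+ n.+2 + y * s) + th) * s `^ a).

Lemma powR_pred (R : realType) (a s : R) : 0 < s -> s `^ (a - 1) * s = s `^ a.
Proof.
move=> s0; rewrite -{2}(powRr1 (ltW s0)) -powRD ?subrK //.
by rewrite (gt_eqF s0) implybT.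
Qed.

Lemma is_derive_expr (R : realType) (n : nat) (s : R) :
  is_derive s 1 (fun t : R => t ^+ n.+1) (n.+1%:R * s ^+ n).
Proof.
have -> : (fun t : R => t ^+ n.+1) = @id R ^+ n.+1.
  by rewrite exprfctE.
by apply: is_derive_eq; rewrite /GRing.scale /= mulr1.
Qed.

(** [nonstationary_le] with phase [lam * (s ^+ n.+2 + y * s) + th] and
    [g = s `^ a / (lam * slope s)].  The two summands of the hypothesis on [dG]
    come from differentiating [s `^ a] and [1 / slope s] respectively; a factor
    [s `^ (a - 1)] has been taken out of both. *)
Lemma osc_increment_le (R : realType) (n : nat) (a lam y th : R)
    (f G dG : R -> R) (u v : R) :
  0 < lam -> 0 < u -> u <= v -> osc_primitive n a lam y th f ->
  (forall s : R, u <= s <= v -> slope n y s != 0) ->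
  (forall s : R, u <= s <= v -> is_derive s 1 G (dG s)) ->
  (forall s : R, u <= s <= v ->
    s `^ (a - 1) * (`|a| / `|slope n y s| +
      n.+2%:R * n.+1%:R * s ^+ n.+1 / slope n y s ^+ 2) <= dG s) ->
  `|f v - f u| <=
    lam^-1 * (u `^ a / `|slope n y u| + v `^ a / `|slope n y v| + (G v - G u)).
Proof.
move=> lam0 u0 uv Df sl0 DG le_dG.
have l0 : lam != 0 by rewrite gt_eqF.
pose c : R := n.+2%:R * n.+1%:R.
pose P s : R := lam * (s ^+ n.+2 + y * s) + th.
pose g s : R := lam^-1 * (s `^ a / slope n y s).
pose dg s : R := lam^-1 * (s `^ (a - 1) *
  (a / slope n y s - c * s ^+ n.+1 / slope n y s ^+ 2)).
have Dsl (s : R) : is_derive s 1 (slope n y) (c * s ^+ n).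
  have Dx := is_derive_expr n s.
  apply: (@is_derive_eq _ _ _ (n.+2%:R \*: (fun t : R => t ^+ n.+1) + cst y)).
  by rewrite /= /GRing.scale /= addr0 mulrA.
have DP (s : R) : is_derive s 1 P (lam * slope n y s).
  have Dx := is_derive_expr n.+1 s.
  apply: (@is_derive_eq _ _ _
    (lam \*: ((fun t : R => t ^+ n.+2) + y \*: @id R) + cst th)).
  by rewrite /= /GRing.scale /= mulr1 addr0.
have := @nonstationary_le R f P (fun s => lam * slope n y s) g dg
  (fun s => lam^-1 * G s) (fun s => lam^-1 * dG s) u v uv.
have gE (s : R) : 0 < s -> `|g s| = lam^-1 * (s `^ a / `|slope n y s|).
  move=> s0; rewrite /g normrM gtr0_norm ?invr_gt0 // normrM normfV.
  by rewrite (ger0_norm (powR_ge0 _ _)).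
rewrite (gE u) // (gE v) ?(lt_le_trans u0) //.
rewrite -mulrDr -mulrBr -mulrDr; apply => s suv.
- have [us _] := andP suv; have s0 := lt_le_trans u0 us.
  apply: is_derive_eq (Df s s0) _.
  rewrite /P /g /=; congr (_ * _); field.
  by rewrite l0 sl0.
- have [us _] := andP suv; have s0 := lt_le_trans u0 us.
  have Dp := is_derive1_powR a s0.
  have Di : is_derive s 1 (fun s => (slope n y s)^-1)
      (- slope n y s ^- 2 * (c * s ^+ n)).
    have [Dsl1 Dsl2] := Dsl s; split; first exact: derivableV (sl0 s suv) _.
    by rewrite deriveV ?sl0 // Dsl2.
  have Dg : is_derive s 1 g _ := is_deriveZ lam^-1 (is_deriveM Dp Di).
  apply: (is_derive_eq Dg).
  rewrite /dg /= /GRing.scale /= -(powR_pred _ s0) (exprS s n); field.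
  by rewrite l0 sl0.
- have D := DG s suv; exact: is_deriveZ.
- have [us _] := andP suv; have s0 := lt_le_trans u0 us.
  rewrite /dg normrM gtr0_norm ?invr_gt0 // ler_pM2l ?invr_gt0 //.
  apply: le_trans (le_dG s suv).
  rewrite normrM (ger0_norm (powR_ge0 _ _)) ler_pM2l ?powR_gt0 //.
  rewrite (le_trans (ler_normB _ _)) // normrM normfV lerD2l.
  rewrite ger0_norm // !mulr_ge0 ?invr_ge0 ?sqr_ge0 ?exprn_ge0 ?ltW //.
Qed.

(** * Intervals where the phase is not stationary *)

Lemma powR_antitone (R : realType) (r u v : R) :
  0 < u -> u <= v -> r <= 0 -> v `^ r <= u `^ r.
Proof.
move=> u0 uv r0; have v0 := lt_le_trans u0 uv.
rewrite -[r]opprK (powRN v) (powRN u) lef_pV2 ?posrE ?powR_gt0 //.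
by apply: ge0_ler_powR; rewrite ?nnegrE ?oppr_ge0 // ltW.
Qed.

(** Turns a lower bound [q] on the slope into an upper bound on the
    expression that [dG] has to dominate in [osc_increment_le]. *)
Lemma slope_bound_le (R : realType) (k c p sl q : R) :
  0 <= k -> 0 <= c -> 0 <= p -> 0 < q -> q <= `|sl| ->
  k / `|sl| + c * p / sl ^+ 2 <= k / q + c * p / q ^+ 2.
Proof.
move=> k0 c0 p0 q0 qsl; have sl0 := lt_le_trans q0 qsl.
have sl2 : q ^+ 2 <= sl ^+ 2.
  by rewrite -[leRHS]real_normK ?num_real // lerXn2r // nnegrE ltW.
have q2 : 0 < q ^+ 2 by rewrite exprn_gt0.
have sl2_gt0 := lt_le_trans q2 sl2.
by rewrite lerD // ler_wpM2l ?mulr_ge0 // lef_pV2 ?posrE.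
Qed.

(** For [s >= 1] the leading term dominates: [n.+2 * s ^+ n.+1 + y] is at
    least [n.+1 * s ^+ n.+1], since [`|y| <= 1].  So [g'] is of order
    [s `^ (a - n.+2)], which is integrable at infinity because [a < n.+1]. *)
Lemma tail_le (R : realType) (n : nat) (a : R) : a < n.+1%:R ->
  exists2 K : R, 0 < K & forall (lam y th : R) (f : R -> R) (u v : R),
    0 < lam -> `|y| <= 1 -> osc_primitive n a lam y th f ->
    1 <= u -> u <= v ->
    `|f v - f u| <= lam^-1 * (K * u `^ (a - n.+1%:R)).
Proof.
move=> an; pose c : R := n.+2%:R * n.+1%:R.
pose m : R := n.+1%:R - a.
have m0 : 0 < m by rewrite subr_gt0.
have c0 : 0 <= c by rewrite mulr_ge0.
have k0 : 0 <= `|a| + c by rewrite addr_ge0.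
exists (2 + (`|a| + c) / m).
  by rewrite ltr_wpDr // divr_ge0 // ltW.
move=> lam y th f u v lam0 y1 Df u1 uv.
have u0 : 0 < u := lt_le_trans ltr01 u1.
have slP (s : R) : 1 <= s -> s ^+ n.+1 <= `|slope n y s|.
  move=> s1; have p1 : 1 <= s ^+ n.+1 by rewrite exprn_ege1.
  apply: le_trans (ler_norm _); rewrite /slope.
  have n1 : 1 <= n.+1%:R :> R by rewrite ler1n.
  have : s ^+ n.+1 <= n.+1%:R * s ^+ n.+1 by rewrite ler_peMl //
    (le_trans ler01).
  have : n.+2%:R * s ^+ n.+1 = n.+1%:R * s ^+ n.+1 + s ^+ n.+1.
    by rewrite -[n.+2]addn1 natrD mulrDl mul1r.
  by have := lerNnormlW y1; lra.
have powB (r s : R) : 0 < s -> s `^ r / s ^+ n.+1 = s `^ (r - n.+1%:R).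
  move=> s0; rewrite -powR_mulrn ?ltW // powRB //.
  by rewrite (gt_eqF s0) implybT.
pose G (s : R) := - ((`|a| + c) / m) * s `^ (a - n.+1%:R).
pose dG (s : R) := (`|a| + c) * s `^ (a - 1 - n.+1%:R).
have sb (s : R) : u <= s <= v -> 1 <= s.
  by move=> /andP[us _]; exact: le_trans us.
apply: (le_trans (@osc_increment_le R n a lam y th f G dG u v lam0 u0 uv Df
  _ _ _)).
- move=> s /sb s1; rewrite -normr_gt0 (lt_le_trans _ (slP _ s1)) //.
  by rewrite exprn_gt0 // (lt_le_trans ltr01).
- move=> s /sb s1; have s0 : 0 < s := lt_le_trans ltr01 s1.
  have Dp := is_derive1_powR (a - n.+1%:R) s0.
  have DG : is_derive s 1 G _ := is_deriveZ (- ((`|a| + c) / m)) Dp.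
  apply: (is_derive_eq DG); rewrite /dG /GRing.scale /= /m.
  have -> : a - n.+1%:R - 1 = a - 1 - n.+1%:R by ring.
  by field; rewrite nat1r gt_eqF.
- move=> s /sb s1; have s0 : 0 < s := lt_le_trans ltr01 s1.
  have p0 : 0 < s ^+ n.+1 by rewrite exprn_gt0.
  apply: (@le_trans _ _ (s `^ (a - 1) *
     (`|a| / s ^+ n.+1 + c * s ^+ n.+1 / (s ^+ n.+1) ^+ 2))).
    rewrite ler_wpM2l ?powR_ge0 //; apply: slope_bound_le => //;
      first exact: ltW.
    exact: slP.
  rewrite /dG -powB // le_eqVlt; apply/orP; left; apply/eqP; field.
  by rewrite gt_eqF.
rewrite ler_pM2l ?invr_gt0 //.
have gb (s : R) : u <= s <= v -> s `^ a / `|slope n y s| <= u `^ (a - n.+1%:R).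
  move=> suv; have s1 := sb s suv; have s0 : 0 < s := lt_le_trans ltr01 s1.
  apply: (@le_trans _ _ (s `^ a / s ^+ n.+1)).
    rewrite ler_wpM2l ?powR_ge0 // lef_pV2 ?posrE ?exprn_gt0 ?slP //.
    by rewrite (lt_le_trans _ (slP s s1)) // exprn_gt0.
  rewrite powB // powR_antitone //; first by case/andP: suv.
  by rewrite subr_le0 ltW.
have := gb u; have := gb v; rewrite !lexx uv /= => /(_ isT) gv /(_ isT) gu.
have : G v - G u <= (`|a| + c) / m * u `^ (a - n.+1%:R).
  have : 0 <= (`|a| + c) / m * v `^ (a - n.+1%:R).
    by rewrite mulr_ge0 ?powR_ge0 // divr_ge0 // ltW.
  rewrite /G; lra.
by lra.
Qed.

(** With the slope bounded below, [g'] is of order [s `^ (a - 1)], which may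
    fail to be integrable at [0] and may even have a logarithmic primitive.
    Lowering the exponent to some [a' <= -1/2] is harmless on [s <= 1] and gives
    a genuine power, whose increment is governed by the left end point. *)
Lemma head_le (R : realType) (n : nat) (a a' lam y th : R) (f : R -> R)
    (u v : R) :
  a' <= a -> a' <= - (1 / 2) -> 0 < lam -> osc_primitive n a lam y th f ->
  0 < u -> u <= v -> v <= 1 ->
  (forall s : R, u <= s <= v -> 1 / 2 <= `|slope n y s|) ->
  `|f v - f u| <=
    lam^-1 * ((4 + 8 * (`|a| + n.+2%:R * n.+1%:R)) * u `^ a').
Proof.
move=> aa a2 lam0 Df u0 uv v1 slP; set c : R := n.+2%:R * n.+1%:R.
have c0 : 0 <= c by rewrite mulr_ge0.
have k0 : 0 <= `|a| + c by rewrite addr_ge0.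
have an0 : a' < 0 by lra.
have sb (s : R) : u <= s <= v -> 0 < s <= 1.
  by move=> /andP[us sv]; rewrite (lt_le_trans u0 us) (le_trans sv v1).
pose G (s : R) := 4 * (`|a| + c) / a' * s `^ a'.
pose dG (s : R) := 4 * (`|a| + c) * s `^ (a' - 1).
apply: (le_trans (@osc_increment_le R n a lam y th f G dG u v lam0 u0 uv Df
  _ _ _)).
- move=> s /slP ?; rewrite -normr_gt0; lra.
- move=> s /sb /andP[s0 _].
  have Dp := is_derive1_powR a' s0.
  have DG : is_derive s 1 G _ := is_deriveZ (4 * (`|a| + c) / a') Dp.
  apply: (is_derive_eq DG); rewrite /dG /GRing.scale /=.
  by field; rewrite lt_eqF.
- move=> s suv; have /andP[s0 s1] := sb s suv.
  have p1 : s ^+ n.+1 <= 1 by rewrite exprn_ile1 // ltW.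
  have p0 : 0 <= s ^+ n.+1 by rewrite exprn_ge0 // ltW.
  rewrite /dG mulrC; apply: ler_pM.
  + by rewrite addr_ge0 ?mulr_ge0 ?invr_ge0 ?sqr_ge0.
  + exact: powR_ge0.
  + apply: le_trans (slope_bound_le _ _ _ _ (slP s suv)) _ => //.
    have cp : c * s ^+ n.+1 <= c by rewrite ler_piMr.
    have -> : `|a| / (1 / 2) + c * s ^+ n.+1 / (1 / 2) ^+ 2 =
        2 * `|a| + 4 * (c * s ^+ n.+1) by field.
    have a0 := normr_ge0 a; lra.
  + by rewrite ger_powR ?s0 // lerD2r.
rewrite ler_pM2l ?invr_gt0 //.
have gb (s : R) : u <= s <= v -> s `^ a / `|slope n y s| <= 2 * u `^ a'.
  move=> suv; have /andP[s0 s1] := sb s suv.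
  rewrite mulrC; apply: ler_pM; rewrite ?invr_ge0 ?powR_ge0 //.
    have := slP s suv => sl; rewrite invf_ple ?posrE; lra.
  apply: (@le_trans _ _ (s `^ a')); first by rewrite ger_powR ?s0.
  by apply: powR_antitone => //; [case/andP: suv | exact: ltW].
have := gb u; have := gb v; rewrite !lexx uv /= => /(_ isT) gv /(_ isT) gu.
have an2 : - a'^-1 <= 2.
  by rewrite -invrN invf_ple ?posrE; lra.
have an3 : 0 < - a'^-1 by rewrite oppr_gt0 invr_lt0.
have : G v - G u <= 8 * (`|a| + c) * u `^ a'.
  have e s : G s = - (4 * ((`|a| + c) * s `^ a') * - a'^-1) by rewrite /G; ring.
  rewrite !e opprK.
  have : 0 <= 4 * ((`|a| + c) * v `^ a') * - a'^-1.
    by rewrite !mulr_ge0 ?powR_ge0 // ltW.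
  have : 4 * ((`|a| + c) * u `^ a') * - a'^-1 <= 4 * ((`|a| + c) * u `^ a') * 2.
    by rewrite ler_wpM2l // !mulr_ge0 ?powR_ge0.
  lra.
by lra.
Qed.

(** * The stationary point *)

Lemma exists_stationary_point (R : realType) (n : nat) :
  exists s0 : R, [/\ 0 < s0, s0 <= 1 & n.+2%:R * s0 ^+ n.+1 = 1].
Proof.
have b0 : 0 < n.+2%:R :> R by rewrite ltr0n.
exists (n.+2%:R `^ (- n.+1%:R^-1)); split; first by rewrite powR_gt0.
  by rewrite -[leRHS](powRr0 n.+2%:R) ler_powR ?ler1n // oppr_le0 invr_ge0.
rewrite -powR_mulrn ?powR_ge0 // -powRrM mulNr mulVf ?pnatr_eq0 //.
by rewrite powR_inv1 ?ltW // mulfV // gt_eqF.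
Qed.

(** Factor [s ^+ n.+1 - s0 ^+ n.+1]; already the last term [s0 ^+ n] of the
    cofactor, multiplied by [n.+2], is at least [n.+2 * s0 ^+ n.+1 = 1]. *)
Lemma slope_ge_dist (R : realType) (n : nat) (s0 s : R) :
  0 < s0 -> s0 <= 1 -> n.+2%:R * s0 ^+ n.+1 = 1 -> 0 <= s ->
  `|s - s0| <= `|slope n (-1) s|.
Proof.
move=> s00 s01 s0E s_ge0.
have -> : slope n (-1) s = (s - s0) *
    (n.+2%:R * \sum_(i < n.+1) s ^+ (n.+1.-1 - i) * s0 ^+ i).
  transitivity (n.+2%:R * (s ^+ n.+1 - s0 ^+ n.+1)).
    by rewrite mulrBr s0E.
  by rewrite subrXX; ring.
rewrite normrM ler_peMr // (le_trans _ (ler_norm _)) //.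
rewrite -[leLHS]s0E ler_wpM2l // big_ord_recr /= subnn expr0 mul1r ler_wpDl //.
  by rewrite sumr_ge0 // => i _; rewrite mulr_ge0 ?exprn_ge0 // ltW.
by rewrite exprS ler_piMl // exprn_ge0 // ltW.
Qed.

Lemma amplitude_le (R : realType) (n : nat) (a lam y th M : R) (f : R -> R)
    (u v : R) :
  0 < u -> u <= v -> osc_primitive n a lam y th f ->
  (forall s : R, u <= s <= v -> s `^ a <= M) ->
  `|f v - f u| <= M * (v - u).
Proof.
move=> u0 uv Df leM; rewrite mulrBr.
apply: (@increment_le R f _ (fun s => M * s) (fun _ => M) u v uv) => s suv.
- by apply: Df; case/andP: suv => /(lt_le_trans u0).
- apply: (@is_derive_eq _ _ _ (M \*: @id R)).
  by rewrite /GRing.scale /= mulr1.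
- rewrite normrM (ger0_norm (powR_ge0 _ _)) (le_trans _ (leM s suv)) //.
  by rewrite ler_piMl ?powR_ge0 // ler_norml cos_geN1 cos_le1.
Qed.

Lemma powR_le_ends (R : realType) (r u v s : R) : 0 < u -> u <= s <= v ->
  s `^ r <= u `^ r + v `^ r.
Proof.
move=> u0 /andP[us sv]; have s0 := lt_le_trans u0 us.
have [r0|r0] := leP r 0.
  by rewrite ler_wpDr ?powR_ge0 // powR_antitone.
rewrite ler_wpDl ?powR_ge0 //.
have v0 := lt_le_trans s0 sv.
by apply: ge0_ler_powR => //; rewrite ?nnegrE; exact: ltW.
Qed.

(** Around the stationary point all the powers of [s] are bounded and [g'] is
    of order [1 / (s - s0) ^+ 2], whose primitive [- 1 / (s - s0)] is at most
    [1 / d] in absolute value.  The statement covers both sides of [s0]. *)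
Lemma near_stationary_le (R : realType) (n : nat) (a s0 : R) :
  0 < s0 -> s0 <= 1 -> n.+2%:R * s0 ^+ n.+1 = 1 ->
  exists2 K : R, 0 < K & forall (lam th : R) (f : R -> R) (u v d : R),
    0 < lam -> 0 < d -> osc_primitive n a lam (-1) th f ->
    s0 / 2 <= u -> u <= v -> v <= 2 ->
    (forall s : R, u <= s <= v -> d <= `|s - s0|) ->
    `|f v - f u| <= lam^-1 * (K / d).
Proof.
move=> s00 s01 s0E; pose c : R := n.+2%:R * n.+1%:R.
have c0 : 0 <= c by rewrite mulr_ge0.
pose A : R := (s0 / 2) `^ (a - 1) + 2 `^ (a - 1).
have A0 : 0 < A by rewrite addr_gt0 // powR_gt0 // divr_gt0.
pose M : R := A * (2 * `|a| + c * 2 ^+ n.+1).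
have M0 : 0 <= M.
  by rewrite mulr_ge0 ?(ltW A0) // addr_ge0 ?mulr_ge0 ?exprn_ge0.
exists (4 * A + 2 * M); first by lra.
move=> lam th f u v d lam0 d0 Df u1 uv v1 dP.
have u0 : 0 < u by apply: lt_le_trans u1; rewrite divr_gt0.
have sb (s : R) : u <= s <= v -> 0 < s /\ s0 / 2 <= s <= 2.
  by move=> /andP[us sv]; rewrite (lt_le_trans u0 us) (le_trans u1 us)
    (le_trans sv v1).
have sA (s : R) : s0 / 2 <= s <= 2 -> s `^ (a - 1) <= A.
  by move=> sP; apply: powR_le_ends => //; rewrite divr_gt0.
have ds (s : R) : u <= s <= v -> 0 < `|s - s0|.
  by move=> /dP; exact: lt_le_trans.
have slP (s : R) : u <= s <= v -> `|s - s0| <= `|slope n (-1) s|.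
  by move=> /sb[sp _]; apply: slope_ge_dist => //; exact: ltW.
pose G (s : R) := - M * (s - s0)^-1.
pose dG (s : R) := M * (s - s0) ^- 2.
apply: (le_trans (@osc_increment_le R n a lam (-1) th f G dG u v lam0 u0 uv Df
  _ _ _)).
- by move=> s suv; rewrite -normr_gt0 (lt_le_trans (ds s suv)) ?slP.
- move=> s suv; have sn0 : s - s0 != 0 by rewrite -normr_gt0 ds.
  have Di : is_derive s 1 (fun t : R => (t - s0)^-1) (- (s - s0) ^- 2).
    have [D1 D2] : is_derive s 1 (fun t : R => t - s0) 1.
      by apply: (@is_derive_eq _ _ _ (@id R - cst s0)); rewrite subr0.
    split; first exact: derivableV.
    by rewrite deriveV // D2 /GRing.scale /= mulr1.
  have DG : is_derive s 1 G _ := is_deriveZ (- M) Di.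
  apply: (is_derive_eq DG); rewrite /dG /GRing.scale /=; ring.
- move=> s suv; have [sp sP] := sb s suv.
  have p0 : 0 <= s ^+ n.+1 by rewrite exprn_ge0 // ltW.
  have p1 : s ^+ n.+1 <= 2 ^+ n.+1.
    by rewrite lerXn2r ?nnegrE ?(ltW sp) //; case/andP: sP.
  have q2 : `|s - s0| <= 2.
    by case/andP: sP => ? ?; rewrite ler_norml; apply/andP; split; lra.
  apply: (@le_trans _ _ (A * ((2 * `|a| + c * 2 ^+ n.+1) / `|s - s0| ^+ 2))).
    apply: ler_pM; rewrite ?powR_ge0 ?sA //.
      by rewrite addr_ge0 ?mulr_ge0 ?invr_ge0 ?sqr_ge0.
    apply: (le_trans (slope_bound_le _ _ _ (ds s suv) (slP s suv))) => //.
    have -> : `|a| / `|s - s0| = `|a| * `|s - s0| / `|s - s0| ^+ 2.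
      by field; rewrite gt_eqF ?ds.
    rewrite -mulrDl ler_wpM2r ?invr_ge0 ?sqr_ge0 // lerD //.
      by rewrite mulrC ler_wpM2r.
    by rewrite ler_wpM2l.
  by rewrite /dG /M real_normK ?num_real // mulrA.
rewrite ler_pM2l ?invr_gt0 //.
have gb (s : R) : u <= s <= v -> s `^ a / `|slope n (-1) s| <= 2 * A / d.
  move=> suv; have [sp sP] := sb s suv; apply: ler_pM.
  - exact: powR_ge0.
  - by rewrite invr_ge0.
  - rewrite -(powR_pred a sp) [leRHS]mulrC; apply: ler_pM;
      rewrite ?powR_ge0 ?(ltW sp) ?sA //.
    by case/andP: sP.
  - have le_d := le_trans (dP s suv) (slP s suv).
    by rewrite lef_pV2 ?posrE // (lt_le_trans d0).
have Gb (s : R) : u <= s <= v -> `|G s| <= M / d.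
  move=> suv; rewrite /G normrM normrN (ger0_norm M0) normfV ler_wpM2l //.
  by rewrite lef_pV2 ?posrE ?ds ?dP.
have := gb u; have := gb v; have := Gb u; have := Gb v.
rewrite !lexx uv /= => /(_ isT) Gv /(_ isT) Gu /(_ isT) gv /(_ isT) gu.
have := ler_normB (G v) (G u); have := ler_norm (G v - G u).
rewrite (_ : (4 * A + 2 * M) / d = 2 * (2 * A / d) + 2 * (M / d)); last by ring.
lra.
Qed.

(** The window of half-width [d] around [s0] contributes [O(d)] by its length,
    and the two sides contribute [O(1 / (lam * d))]; the two balance for
    [d = lam `^ (-1/2)].  The lower bound on [lam] says that the window stays to
    the right of [s0 / 2]. *)
Lemma stationary_le (R : realType) (n : nat) (a s0 : R) :
  0 < s0 -> s0 <= 1 -> n.+2%:R * s0 ^+ n.+1 = 1 ->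
  exists2 K : R, 0 < K & forall (lam th : R) (f : R -> R),
    4 / s0 ^+ 2 <= lam -> osc_primitive n a lam (-1) th f ->
    `|f 2 - f (s0 / 2)| <= K * lam `^ (- (1 / 2)).
Proof.
move=> s00 s01 s0E; have [K K0 near_le] := near_stationary_le a s00 s01 s0E.
pose A : R := (s0 / 2) `^ a + 2 `^ a.
have A0 : 0 < A by rewrite addr_gt0 // powR_gt0 // divr_gt0.
exists (2 * K + 2 * A); first by lra.
move=> lam th f lam_ge Df; set d := lam `^ (- (1 / 2)).
have lam0 : 0 < lam by apply: lt_le_trans lam_ge; rewrite divr_gt0 // exprn_gt0.
have d0 : 0 < d by rewrite powR_gt0.
have d2 : d ^+ 2 = lam^-1.
  rewrite /d -powR_mulrn ?powR_ge0 // -powRrM -(powR_inv1 (ltW lam0)).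
  by congr (_ `^ _); field.
have ds0 : d <= s0 / 2.
  rewrite -ler_sqr ?nnegrE ?divr_ge0 ?(ltW s00) ?(ltW d0) // d2.
  rewrite invf_ple ?posrE ?exprn_gt0 ?divr_gt0 //.
  by rewrite (_ : (_ ^+ 2)^-1 = 4 / s0 ^+ 2) //; field; rewrite gt_eqF.
(* This is the balance that dictates the choice of [d]. *)
have lamd : lam^-1 * (K / d) = K * d.
  by rewrite -d2; field; rewrite gt_eqF.
have s20 : 0 < s0 / 2 by lra.
have left : `|f (s0 - d) - f (s0 / 2)| <= K * d.
  rewrite -lamd; apply: (near_le lam th) => //; try lra.
  move=> s /andP[_ ss]; rewrite ler0_norm; lra.
have right : `|f 2 - f (s0 + d)| <= K * d.
  rewrite -lamd; apply: (near_le lam th) => //; try lra.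
  move=> s /andP[ss _]; rewrite ger0_norm; lra.
have middle : `|f (s0 + d) - f (s0 - d)| <= A * (s0 + d - (s0 - d)).
  apply: amplitude_le Df _; try lra.
  by move=> s /andP[us sv]; apply: powR_le_ends => //; apply/andP; split; lra.
have := ler_distD (f (s0 + d)) (f 2) (f (s0 / 2)).
have := ler_distD (f (s0 - d)) (f (s0 + d)) (f (s0 / 2)).
have -> : (2 * K + 2 * A) * d = K * d + K * d + A * (s0 + d - (s0 - d)) by ring.
lra.
Qed.

(** * The scaled estimate *)

(** For [y = 1] the pieces are [s <= 1/lam], [1/lam <= s <= 1] and [s >= 1];
    for [y = -1] they are [s <= 1/lam], [1/lam <= s <= s0/2],
    [s0/2 <= s <= 2] and [s >= 2].  Bounded values of [lam], among them
    [lam = 1] with an arbitrary [y], need only the trivial bound up to [1] and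
    the tail estimate. *)
Lemma scaled_le (R : realType) (n : nat) (a : R) : -1 < a -> a < n.+1%:R ->
  exists2 K : R, 0 < K & forall (lam y th : R) (f : R -> R) (S : R),
    1 <= lam -> `|y| <= 1 -> lam = 1 \/ `|y| = 1 ->
    osc_primitive n a lam y th f ->
    (forall s : R, 0 < s -> `|f s| <= s `^ (1 + a) / (1 + a)) ->
    2 <= S -> `|f S| <= K * lam `^ (-1 - Num.min a (- (1 / 2))).
Proof.
move=> a1 an; set a' := Num.min a (- (1 / 2)).
have a'a : a' <= a by rewrite /a' ge_min lexx.
have a'2 : a' <= - (1 / 2) by rewrite /a' ge_min lexx orbT.
have a'1 : -1 < a' by rewrite /a' lt_min a1 /=; lra.
have [s0 [s00 s01 s0E]] := exists_stationary_point R n.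
have [Kt Kt0 tailP] := tail_le an.
have [Ks Ks0 statP] := stationary_le a s00 s01 s0E.
pose Kh : R := 4 + 8 * (`|a| + n.+2%:R * n.+1%:R).
have Kh0 : 0 < Kh.
  by rewrite ltr_wpDr // mulr_ge0 // addr_ge0 // mulr_ge0.
pose i : R := (1 + a)^-1.
have i0 : 0 < i by rewrite invr_gt0; lra.
(* Below [L] the estimate near the stationary point is not available. *)
pose L : R := 4 / s0 ^+ 2.
have L1 : 1 <= L.
  rewrite /L ler_pdivlMr ?exprn_gt0 // mul1r.
  have : s0 ^+ 2 <= 1 by rewrite exprn_ile1 // ltW.
  lra.
have L0 : 0 < L := lt_le_trans ltr01 L1.
exists (i + Kh + Ks + Kt + (i + Kt) * L `^ (1 + a')).
  by rewrite !addr_gt0 // mulr_gt0 ?powR_gt0 // addr_gt0.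
move=> lam y th f S lam1 y1 ly Df f_le S2; set B := lam `^ (-1 - a').
have lam0 : 0 < lam := lt_le_trans ltr01 lam1.
have B0 : 0 < B by rewrite powR_gt0.
have KL0 : 0 <= (i + Kt) * L `^ (1 + a') * B.
  by rewrite !mulr_ge0 ?powR_ge0 ?ltW // addr_gt0.
have lamB (r : R) : r <= -1 - a' -> lam `^ r <= B by move=> ?; rewrite ler_powR.
have lamVB : lam^-1 <= B by rewrite -powR_inv1 ?(ltW lam0) // lamB //; lra.
have B1 : lam^-1 * lam^-1 `^ a' = B.
  rewrite -powR_inv1 ?(ltW lam0) // -powRrM -powRD ?(gt_eqF lam0) ?implybT //.
  by congr (_ `^ _); ring.
have tail u : 1 <= u -> u <= S -> `|f S - f u| <= Kt * B.
  move=> u1 uS; apply: (le_trans (tailP lam y th f u S lam0 y1 Df u1 uS)).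
  rewrite mulrC -mulrA ler_pM2l //.
  rewrite -[leRHS]mul1r; apply: ler_pM; rewrite ?powR_ge0 ?invr_ge0 ?(ltW
    lam0) //.
  rewrite -[leRHS](powRr0 u) ler_powR // subr_le0 ltW //.
have head v : lam^-1 <= v -> v <= 1 ->
    (forall s : R, lam^-1 <= s <= v -> 1 / 2 <= `|slope n y s|) ->
    `|f v - f lam^-1| <= Kh * B.
  move=> lv v1 slP.
  have := @head_le R n a a' lam y th f lam^-1 v a'a a'2 lam0 Df _ lv v1 slP.
  by rewrite invr_gt0 mulrCA B1 => /(_ lam0).
(* At [1 / lam] the trivial bound is already of the required size. *)
have origin : `|f lam^-1| <= i * B.
  apply: (le_trans (f_le _ _)); first by rewrite invr_gt0.
  rewrite mulrC ler_pM2l // -powR_inv1 ?(ltW lam0) // -powRrM lamB //; lra.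
have [lamL|Llam] := leP lam L.
  have f1 : `|f 1| <= i.
    by have := f_le 1 ltr01; rewrite powR1 mul1r.
  have fS : `|f S - f 1| <= Kt.
    apply: (le_trans (tailP lam y th f 1 S lam0 y1 Df (lexx 1) _)); first lra.
    rewrite powR1 mulr1 ler_piMl ?(ltW Kt0) // invf_le1 //.
  (* For bounded [lam] the target [lam `^ (-1 - a')] is bounded below. *)
  have LB : 1 <= L `^ (1 + a') * B.
    have {1}<- : lam `^ (1 + a') * B = 1.
      rewrite -powRD ?(gt_eqF lam0) ?implybT //.
      by rewrite (_ : _ + _ = 0) ?powRr0 //; ring.
    rewrite ler_pM2r //; apply: ge0_ler_powR;
      rewrite ?nnegrE ?(ltW lam0) ?(ltW L0) //.
    lra.
  have iKt : 0 < i + Kt by rewrite addr_gt0.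
  have : (i + Kt) <= (i + Kt) * L `^ (1 + a') * B by rewrite -mulrA ler_peMr
    // ltW.
  have := ler_normD (f S - f 1) (f 1); rewrite subrK.
  have : 0 <= i * B + Kh * B + Ks * B + Kt * B.
    by rewrite !addr_ge0 // mulr_ge0 // ltW.
  lra.
have {}ly : `|y| = 1 by case: ly => // lam_eq; lra.
have KsB : 0 <= Ks * B by rewrite mulr_ge0 // ltW.
have split3 p q : `|f S| <= `|f S - f p| + (`|f p - f q| + `|f q|).
  have := ler_normD (f S - f p) (f p); rewrite subrK.
  have := ler_normD (f p - f q) (f q); rewrite subrK; lra.
have [y0|y0] := leP 0 y.
  have yE : y = 1 by rewrite ger0_norm in ly.
  have hd : `|f 1 - f lam^-1| <= Kh * B.
    apply: head (lexx 1) _; first by rewrite invf_le1.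
    move=> s /andP[ls _]; have s_ge0 : 0 <= s.
      by rewrite (le_trans _ ls) // invr_ge0 ltW.
    have : 0 <= n.+2%:R * s ^+ n.+1 by rewrite mulr_ge0 // exprn_ge0.
    by move=> p0; rewrite /slope yE ger0_norm; lra.
  have tl : `|f S - f 1| <= Kt * B.
    by apply: tail => //; apply: le_trans S2; rewrite ler1n.
  have := split3 1 lam^-1; lra.
have yE : y = -1 by rewrite ler0_norm ?ltW // in ly; lra.
rewrite {}yE {y y1 ly y0} in Df head.
have s20 : 0 < s0 / 2 by lra.
have lV : lam^-1 <= s0 / 2.
  rewrite invf_ple ?posrE //; apply: le_trans (ltW Llam).
  rewrite invf_div /L ler_pdivlMr ?exprn_gt0 //.
  rewrite (_ : 2 / s0 * s0 ^+ 2 = 2 * s0); first lra.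
  by field; rewrite gt_eqF.
have hd : `|f (s0 / 2) - f lam^-1| <= Kh * B.
  apply: head => //; first lra.
  move=> s /andP[ls sv].
  have s_ge0 : 0 <= s by rewrite (le_trans _ ls) // invr_ge0 ltW.
  have : s ^+ n.+1 <= (1 / 2) * s0 ^+ n.+1.
    apply: (@le_trans _ _ ((s0 / 2) ^+ n.+1)).
      by rewrite lerXn2r ?nnegrE // ltW.
    rewrite exprMn mulrC ler_pM2r ?exprn_gt0 //
      mul1r exprS ler_piMr ?invr_ge0 //.
    by rewrite exprn_ile1 ?invr_ge0 // invf_le1 // ler1n.
  have n2 : 0 <= n.+2%:R :> R by [].
  move=> /(ler_wpM2l n2); rewrite [leRHS]mulrCA s0E mulr1 => le2.
  by rewrite /slope ler0_norm; lra.
have st : `|f 2 - f (s0 / 2)| <= Ks * B.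
  apply: (le_trans (statP lam th f (ltW Llam) Df)).
  rewrite ler_pM2l // lamB //; lra.
have tl : `|f S - f 2| <= Kt * B by apply: tail => //; rewrite ler1n.
have := split3 2 (s0 / 2).
have := ler_normD (f (s0 / 2) - f lam^-1) (f lam^-1); rewrite subrK.
lra.
Qed.

(** * Scaling and the half-line estimate *)

(** Undoing the scaling multiplies [lam `^ (-1 - a')] by [r `^ (1 + a)]; this
    is the resulting exponent of [max 1 |x|].  It equals [-1 - a] when
    [a <= -1/2] and [(a - n.+2 / 2 + 1) / n.+1] otherwise. *)
Definition decay_rate (R : realType) (n : nat) (a : R) : R :=
  (1 + a - n.+2%:R * (1 + Num.min a (- (1 / 2)))) / n.+1%:R.

(** [max 1 x] and [1 + x] differ by a factor between [1] and [2]; the constant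
    is allowed to depend on the exponent, whose sign is arbitrary. *)
Lemma powR_max1_le (R : realType) (e x : R) : 0 <= x ->
  Num.max 1 x `^ e <= 2 `^ `|e| * (1 + x) `^ e.
Proof.
move=> x0; set m := Num.max 1 x.
have m1 : 1 <= m by rewrite /m le_max lexx.
have m0 : 0 < m := lt_le_trans ltr01 m1.
have xm : x <= m by rewrite /m le_max lexx orbT.
have [e0|e0] := leP 0 e.
  apply: (@le_trans _ _ (1 * (1 + x) `^ e)).
    rewrite mul1r; apply: ge0_ler_powR => //;
      rewrite ?nnegrE ?(ltW m0) ?addr_ge0 //.
    by rewrite /m ge_max; apply/andP; split; lra.
  rewrite ler_wpM2r ?powR_ge0 // -[leLHS](powRr0 2) ler_powR // ler1n //.
have x1 : 0 < 1 + x by lra.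
have [k k0 ->] : exists2 k, 0 < k & e = - k.
  by exists (- e); rewrite ?opprK ?oppr_gt0.
rewrite normrN gtr0_norm // (powRN m) (powRN (1 + x)).
have le2 : (1 + x) `^ k <= 2 `^ k * m `^ k.
  rewrite -powRM ?(ltW m0) //.
  apply: ge0_ler_powR; rewrite ?nnegrE ?(ltW x1) ?(ltW k0) ?mulr_ge0 ?(ltW m0)
    //.
  lra.
by rewrite ler_pdivlMr ?powR_gt0 // mulrC ler_pdivrMr ?powR_gt0.
Qed.

Lemma osc_primitive_scale (R : realType) (n : nat) (a x th r : R) (F : R -> R) :
  0 < r -> osc_primitive n a 1 x th F ->
  osc_primitive n a (r ^+ n.+2) (x / r ^+ n.+1) th
    (fun s => r `^ (- (1 + a)) * F (r * s)).
Proof.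
move=> r0 DF s s0; have rs0 : 0 < r * s by rewrite mulr_gt0.
have Dr : is_derive s 1 (fun t : R => r * t) r.
  apply: (@is_derive_eq _ _ _ (r \*: @id R)).
  by rewrite /GRing.scale /= mulr1.
have Dc := @is_derive1_comp R F (fun t : R => r * t) s _ _ (DF _ rs0) Dr.
have D : is_derive s 1 (fun s => r `^ (- (1 + a)) * F (r * s)) _ :=
  is_deriveZ (r `^ (- (1 + a))) Dc.
apply: (is_derive_eq D); rewrite /GRing.scale /=.
have rE : r `^ (- (1 + a)) * (r `^ a * r) = 1.
  rewrite -{3}(powRr1 (ltW r0)) -!powRD ?(gt_eqF r0) ?implybT //.
  by rewrite (_ : _ + _ = 0) ?powRr0 //; ring.
have -> : 1 * ((r * s) ^+ n.+2 + x * (r * s)) + th =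
    r ^+ n.+2 * (s ^+ n.+2 + x / r ^+ n.+1 * s) + th.
  by rewrite exprMn (exprS r n.+1); field; rewrite expf_neq0 // gt_eqF.
rewrite powRM ?ltW //; set C := cos _.
transitivity ((r `^ (- (1 + a)) * (r `^ a * r)) * (C * s `^ a)); first by ring.
by rewrite rE mul1r.
Qed.

Lemma powR_eventually_small (R : realType) (q e : R) : 0 < q -> 0 < e ->
  exists2 u : R, 1 <= u & u `^ (- q) < e.
Proof.
move=> q0 e0; have e20 : 0 < e / 2 by rewrite divr_gt0.
exists (Num.max 1 ((e / 2) `^ (- q^-1))); first by rewrite le_max lexx.
apply: (@le_lt_trans _ _ (((e / 2) `^ (- q^-1)) `^ (- q))).
  apply: powR_antitone; first by rewrite powR_gt0.
    by rewrite le_max lexx orbT.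
  by rewrite oppr_le0 ltW.
by rewrite -powRrM mulrNN mulVf ?gt_eqF // powRr1 ?ltW //; lra.
Qed.

(** Convergence is Cauchy's criterion with [tail_le], and the bound is
    [scaled_le] for every upper limit [A >= 2 * r], which passes to the
    limit. *)
Lemma half_line_le (R : realType) (n : nat) (a : R) : -1 < a -> a < n.+1%:R ->
  exists2 K : R, 0 < K & forall (x th : R) (F : R -> R),
    osc_primitive n a 1 x th F ->
    (forall s : R, 0 < s -> `|F s| <= s `^ (1 + a) / (1 + a)) ->
    exists2 l : R, F A @[A --> +oo] --> l &
      `|l| <= K * (1 + `|x|) `^ decay_rate n a.
Proof.
move=> a1 an; have [Ks Ks0 scaledP] := scaled_le a1 an.
have [Kt Kt0 tailP] := tail_le an.
exists (Ks * 2 `^ `|decay_rate n a|); first by rewrite mulr_gt0 // powR_gt0.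
move=> x th F DF F_le; set e := decay_rate n a.
pose m := Num.max 1 `|x|; pose r := m `^ n.+1%:R^-1.
have m1 : 1 <= m by rewrite /m le_max lexx.
have m0 : 0 < m := lt_le_trans ltr01 m1.
have r0 : 0 < r by rewrite powR_gt0.
have r1 : 1 <= r by rewrite -[leLHS](powRr0 m) ler_powR // invr_ge0.
have rE : r ^+ n.+1 = m.
  by rewrite -powR_mulrn ?powR_ge0 // -powRrM mulVf ?pnatr_eq0 // powRr1 // ltW.
pose f s := r `^ (- (1 + a)) * F (r * s).
pose lam := r ^+ n.+2; pose y := x / m.
have lam1 : 1 <= lam by rewrite exprn_ege1.
have lam0 : 0 < lam := lt_le_trans ltr01 lam1.
have Df : osc_primitive n a lam y th f by rewrite /y -rE;
  exact: osc_primitive_scale.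
have rK : r `^ (1 + a) * r `^ (- (1 + a)) = 1.
  by rewrite powRN mulfV // gt_eqF // powR_gt0.
have f_le (s : R) : 0 < s -> `|f s| <= s `^ (1 + a) / (1 + a).
  move=> s0; have rs0 : 0 < r * s by rewrite mulr_gt0.
  rewrite /f normrM (ger0_norm (powR_ge0 _ _)).
  apply: (le_trans (ler_wpM2l (powR_ge0 _ _) (F_le _ rs0))).
  by rewrite powRM ?(ltW r0) ?(ltW s0) // !mulrA (mulrC (_ `^ (- _))) rK mul1r.
have FE A : F A = r `^ (1 + a) * f (A / r).
  by rewrite /f mulrA rK mul1r mulrCA mulfV ?mulr1 // gt_eqF.
have y1 : `|y| <= 1.
  rewrite /y normrM normfV (gtr0_norm m0) ler_pdivrMr // mul1r.
  by rewrite /m le_max lexx orbT.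
have ly : lam = 1 \/ `|y| = 1.
  have [x1|x1] := leP `|x| 1.
    left; have m_eq : m = 1 by rewrite /m max_l.
    by rewrite /lam /r m_eq powR1 expr1n.
  right; have m_eq : m = `|x| by rewrite /m max_r // ltW.
  by rewrite /y normrM normfV (gtr0_norm m0) m_eq mulfV // -m_eq gt_eqF.
have cvgF : cvg (F A @[A --> +oo]).
  apply: cauchy_cvg; apply: cauchy_exP => eps eps0.
  have q0 : 0 < n.+1%:R - a by rewrite subr_gt0.
  have c0 : 0 < r `^ (1 + a) * (lam^-1 * Kt).
    by rewrite !mulr_gt0 ?powR_gt0 ?invr_gt0.
  have [u u1 u_lt] := powR_eventually_small q0 (divr_gt0 eps0 c0).
  exists (F (r * u)).
  change (\forall A \near +oo, ball (F (r * u)) eps (F A)); near=> A.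
  have uA : u <= A / r.
    rewrite ler_pdivlMr // mulrC; near: A; apply: nbhs_pinfty_ge;
      exact: num_real.
  rewrite /ball /= distrC FE (FE (r * u)) -mulrBr normrM (ger0_norm (powR_ge0
    _ _)).
  have -> : r * u / r = u by field; rewrite gt_eqF.
  apply: (le_lt_trans (ler_wpM2l (powR_ge0 _ _) (tailP lam y th f u _ lam0 y1
    Df u1 uA))).
  rewrite mulrA mulrA -(mulrA _ lam^-1) mulrC -ltr_pdivlMr //.
  by rewrite -opprB.
exists (lim (F A @[A --> +oo])) => //.
apply: (cvgr_to_le (cvg_norm cvgF)).
near=> A.
have A2 : 2 <= A / r.
  by rewrite ler_pdivlMr //; near: A; apply: nbhs_pinfty_ge; exact: num_real.
rewrite FE normrM (ger0_norm (powR_ge0 _ _)).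
apply: (le_trans (ler_wpM2l (powR_ge0 _ _)
  (scaledP lam y th f _ lam1 y1 ly Df f_le A2))).
rewrite mulrCA -mulrA ler_pM2l //.
apply: le_trans (powR_max1_le e (normr_ge0 x)).
rewrite le_eqVlt; apply/orP; left; apply/eqP.
rewrite /lam -powR_mulrn ?(ltW r0) // -powRrM -powRD ?(gt_eqF r0) ?implybT //.
rewrite /r -powRrM; congr (_ `^ _); rewrite /e /decay_rate.
by field; rewrite nat1r pnatr_eq0.
Unshelve. all: by end_near. Qed.

(** * The singularity at the origin *)

(** [t |-> - t] preserves the Lebesgue measure.  Only measurability of [f] is
    asked for, so that the singularity at [0] is allowed. *)
Lemma integral_reflect (R : realType) (f : R -> \bar R) (A : R) :
  measurable_fun [set: R] f ->
  (\int[lebesgue_measure]_(t in `[(- A)%R, 0%R]) f t =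
   \int[lebesgue_measure]_(t in `[0%R, A]) f (- t)%R)%E.
Proof.
move=> mf.
have nonneg (g : R -> \bar R) : measurable_fun [set: R] g ->
    (forall t, 0 <= g t)%E ->
    (\int[lebesgue_measure]_(t in `[(- A)%R, 0%R]) g t =
     \int[lebesgue_measure]_(t in `[0%R, A]) g (- t)%R)%E.
  move=> mg g0.
  have -> : `[0, A]%classic = (-%R : R -> measurableTypeR R) @^-1` `[- A, 0].
    by rewrite opp_preimage_itvbndbnd oppr0 opprK.
  rewrite -ge0_integral_pushforward //=; last exact: measurable_funS mg.
  by apply: eq_measure_integral => //= B mB _; exact/esym/lebesgue_measureN.
rewrite integralE [RHS]integralE; congr (_ - _)%E.
- rewrite nonneg //; first by apply: eq_integral => t _;
    rewrite ?funeposE ?funenegE.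
  exact: measurable_funepos.
- rewrite nonneg //; first by apply: eq_integral => t _;
    rewrite ?funeposE ?funenegE.
  exact: measurable_funeneg.
Qed.

Lemma powR_abs_continuous (R : realType) (a t : R) : t != 0 ->
  {for t, continuous (fun s : R => `|s| `^ a)}.
Proof.
move=> t0; have t_gt0 : 0 < `|t| by rewrite normr_gt0.
have [D _] := is_derive1_powR a t_gt0.
have c : {for `|t|, continuous (fun s : R => s `^ a)}.
  by apply: differentiable_continuous; exact/derivable1_diffP.
by apply: (@continuous_comp _ _ _ (Num.norm : R -> R) (fun s : R => s `^ a));
  [exact: norm_continuous | exact: c].
Qed.

Lemma powR_abs_measurable (R : realType) (a : R) :
  measurable_fun [set: R] (fun s : R => `|s| `^ a).
Proof.
apply: (@measurableT_comp _ _ _ _ _ _ (fun s : R => s `^ a));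
  first exact: measurable_powR.
exact: normr_measurable.
Qed.

Lemma powR_integral_away_le (R : realType) (a u A : R) : -1 < a ->
  0 < u -> u < A ->
  (\int[lebesgue_measure]_(t in `[u, A]) (`|t| `^ a)%:E <=
    (A `^ (1 + a) / (1 + a))%:E)%E.
Proof.
move=> a1 u0 uA; have a10 : 0 < 1 + a by lra.
pose F (t : R) := (1 + a)^-1 * t `^ (1 + a).
have DF (t : R) : 0 < t -> is_derive t 1 F (`|t| `^ a).
  move=> t0; have Dp := is_derive1_powR (1 + a) t0.
  have D : is_derive t 1 F _ := is_deriveZ ((1 + a)^-1) Dp.
  apply: (is_derive_eq D); rewrite /GRing.scale /= gtr0_norm // mulrA.
  by rewrite mulVf ?gt_eqF // mul1r (addrC 1) addrK.
have cF (t : R) : 0 < t -> {for t, continuous F}.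
  move=> /DF[D _]; apply: differentiable_continuous; exact/derivable1_diffP.
have A0 := lt_trans u0 uA.
rewrite (@continuous_FTC2 _ _ F) //.
- rewrite -EFinB lee_fin /F mulrC [leRHS]mulrC lerBlDr mulrC lerDl.
  by rewrite mulr_ge0 ?powR_ge0 // invr_ge0 ltW.
- apply: continuous_in_subspaceT => t; rewrite inE /= in_itv /= => /andP[ut _].
  by apply: powR_abs_continuous; rewrite gt_eqF // (lt_le_trans u0).
- split.
  + move=> t; rewrite in_itv /= => /andP[ut _].
    by have [] := DF t (lt_trans u0 ut).
  + exact/cvg_at_right_filter/cF.
  + exact/cvg_at_left_filter/cF.
- move=> t; rewrite in_itv /= => /andP[ut _].
  by have [_ E] := DF t (lt_trans u0 ut); rewrite derive1E.
Qed.

(** Monotone convergence along the intervals [`[A / k.+2, A]], on which the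
    integrand is continuous and has an explicit primitive. *)
Lemma powR_integral_le (R : realType) (a A : R) : -1 < a -> 0 < A ->
  (\int[lebesgue_measure]_(t in `[0%R, A]) (`|t| `^ a)%:E <=
    (A `^ (1 + a) / (1 + a))%:E)%E.
Proof.
move=> a1 A0.
have mf : measurable_fun [set: R] (fun t : R => (`|t| `^ a)%:E).
  by apply/measurable_EFinP; exact: powR_abs_measurable.
rewrite -integral_itv_obnd_cbnd; last exact: measurable_funS mf.
(* With [k.+2] rather than [k.+1] every interval has a nonempty interior. *)
pose I (k : nat) : set R := `[A / k.+2%:R, A]%classic.
have ndI : nondecreasing_seq I.
  move=> k l kl; rewrite subsetEset => t; rewrite /I /= !in_itv /=.
  move=> /andP[kt ->]; rewrite andbT (le_trans _ kt) // ler_pM2l //.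
  by rewrite lef_pV2 ?posrE ?ltr0n // ler_nat !ltnS.
have -> : `]0, A]%classic = \bigcup_k I k.
  apply/seteqP; split => t /=; rewrite in_itv /=.
    move=> /andP[t0 tA]; exists (Num.bound (A / t)) => //=.
    rewrite /I /= in_itv /= tA andbT ler_pdivrMr ?ltr0n //
      mulrC -ler_pdivrMr //.
    have At : 0 <= A / t by rewrite divr_ge0 // ltW.
    rewrite (le_trans (ltW (archi_boundP At))) // ler_nat.
    by rewrite -addn2 leq_addr.
  move=> [k _]; rewrite /I /= in_itv /= => /andP[kt ->]; rewrite andbT.
  by rewrite (lt_le_trans _ kt) // divr_gt0.
have cvgI : (\int[lebesgue_measure]_(t in I k) (`|t| `^ a)%:E @[k --> \oo] -->
    \int[lebesgue_measure]_(t in \bigcup_k I k) (`|t| `^ a)%:E)%E.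
  apply: ge0_nondecreasing_set_cvg_integral => //.
  - by move=> k; exact: measurable_itv.
  - by move=> k; exact: measurable_funS mf.
apply: (cvge_to_le cvgI); apply: nearW => k.
apply: powR_integral_away_le => //; first exact: divr_gt0.
by rewrite ltr_pdivrMr ?ltr0n // ltr_pMr // ltr1n.
Qed.

(** * Integrals of the oscillating function *)

Definition osc (R : realType) (n : nat) (a x th t : R) : R :=
  cos (t ^+ n.+2 + x * t + th) * `|t| `^ a.

Lemma phase_continuous (R : realType) (n : nat) (x th : R) :
  continuous (fun t : R => cos (t ^+ n.+2 + x * t + th)).
Proof.
move=> t.
apply: (@continuous_comp _ _ _ (fun t : R => t ^+ n.+2 + x * t + th) (@cos R));
  last exact: continuous_cos.
apply: cvgD; last exact: cvg_cst.
by apply: cvgD; [exact: exprn_continuous | apply: cvgM;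
  [exact: cvg_cst | exact: cvg_id]].
Qed.

Lemma osc_continuous (R : realType) (n : nat) (a x th t : R) : t != 0 ->
  {for t, continuous (osc n a x th)}.
Proof.
move=> t0; apply: cvgM; first exact: phase_continuous.
exact: powR_abs_continuous.
Qed.

Lemma osc_measurable (R : realType) (n : nat) (a x th : R) :
  measurable_fun [set: R] (osc n a x th).
Proof.
apply: measurable_funM; last exact: powR_abs_measurable.
by apply: continuous_measurable_fun; exact: phase_continuous.
Qed.

Lemma osc_norm_le (R : realType) (n : nat) (a x th t : R) :
  `|osc n a x th t| <= `|t| `^ a.
Proof.
rewrite /osc normrM (ger0_norm (powR_ge0 _ _)).
by rewrite ler_piMl ?powR_ge0 // ler_norml cos_geN1 cos_le1.
Qed.

Lemma powR_abs_integrable (R : realType) (a A : R) : -1 < a -> 0 < A ->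
  lebesgue_measure.-integrable `[- A, A] (EFin \o (fun t : R => `|t| `^ a)).
Proof.
move=> a1 A0; have mf : measurable_fun [set: R] (fun t : R => (`|t| `^ a)%:E).
  by apply/measurable_EFinP; exact: powR_abs_measurable.
apply/integrableP; split; first exact: measurable_funS mf.
under eq_integral => t _ do rewrite /= (ger0_norm (powR_ge0 _ _)).
have A0' : (BLeft (- A) <= BRight (0 : R))%O by rewrite bnd_simp oppr_le0 ltW.
have A0'' : (BRight (0 : R) <= BRight A)%O by rewrite bnd_simp ltW.
rewrite (itv_bndbnd_setU A0' A0'') ge0_integral_setU //=; last 2 first.
- exact: measurable_funS mf.
- apply/disj_setPS => t [/=]; rewrite !in_itv /= => /andP[_ t0] /andP[].
  by rewrite ltNge t0.
rewrite integral_itv_obnd_cbnd; last exact: measurable_funS mf.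
rewrite (integral_reflect _ mf).
under eq_integral => t _ do rewrite normrN.
by rewrite lte_add_pinfty // (le_lt_trans (powR_integral_le a1 A0)) ?ltry.
Qed.

Lemma osc_integrable (R : realType) (n : nat) (a x th u v : R) : -1 < a ->
  lebesgue_measure.-integrable `[u, v] (EFin \o osc n a x th).
Proof.
move=> a1; pose A := 1 + `|u| + `|v|.
have A0 : 0 < A by rewrite /A; have := normr_ge0 u; have := normr_ge0 v; lra.
have intA : lebesgue_measure.-integrable `[- A, A] (EFin \o osc n a x th).
  apply: le_integrable (powR_abs_integrable a1 A0) => //.
    by apply/measurable_EFinP; exact: measurable_funS (osc_measurable n a x th).
  move=> t _ /=; rewrite lee_fin (ger0_norm (powR_ge0 _ _)).
  exact: osc_norm_le.
apply: integrableS intA => // t /=; rewrite !in_itv /= => /andP[ut tv].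
have := ler_norm v; have := lerNnormlW (lexx `|u|) => ? ?.
by have := normr_ge0 v; have := normr_ge0 u; rewrite /A => ? ?; apply/andP;
  split; lra.
Qed.

Lemma osc_primitive_integral (R : realType) (n : nat) (a x th : R) : -1 < a ->
  osc_primitive n a 1 x th
    (fun A => \int[lebesgue_measure]_(t in `[0, A]) osc n a x th t)%R.
Proof.
move=> a1 A A0.
have A1 : A < A + 1 by rewrite ltrDl.
have [D E] := continuous_FTC1_closed A1 (osc_integrable n x th 0 (A + 1) a1) A0
  (@osc_continuous R n a x th A (lt0r_neq0 A0)).
split => //; rewrite -derive1E E /osc gtr0_norm //.
by rewrite mul1r.
Qed.

Lemma osc_integral_le (R : realType) (n : nat) (a x th A : R) : -1 < a ->
  0 < A ->
  `|\int[lebesgue_measure]_(t in `[0, A]) osc n a x th t|%R <=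
    A `^ (1 + a) / (1 + a).
Proof.
move=> a1 A0; have intf := osc_integrable n x th 0 A a1.
rewrite -lee_fin; apply: le_trans (powR_integral_le a1 A0).
have fin : (\int[lebesgue_measure]_(t in `[0%R, A]) (osc n a x th t)%:E)%E
    \is a fin_num by exact: integrable_fin_num.
rewrite /Rintegral -abse_EFin fineK //.
apply: (le_trans (le_abse_integral _ _ _)) => //.
  exact: (measurable_int lebesgue_measure).
apply: ge0_le_integral => //=.
- apply: measurableT_comp => //; apply: measurableT_comp => //.
  exact: measurable_funS (osc_measurable n a x th).
- apply/measurable_EFinP; exact: measurable_funS (powR_abs_measurable a).
- move=> t _; rewrite lee_fin; exact: osc_norm_le.
Qed.

(** For odd [n.+2] the reflected phase is minus the original one up to the
    constant term, and the cosine is even; for even [n.+2] only [x] changes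
    sign. *)
Lemma osc_reflect (R : realType) (n : nat) (a x th : R) :
  exists x' th' : R, `|x'| = `|x| /\
    forall t, osc n a x th (- t) = osc n a x' th' t.
Proof.
have powN (t : R) : (- t) ^+ n.+2 = (-1) ^+ odd n.+2 * t ^+ n.+2.
  by rewrite (exprNn t) -(signr_odd R n.+2).
case: (boolP (odd n.+2)) => nO.
- exists x, (- th); split=> // t; rewrite /osc normrN powN nO expr1 -cosN.
  congr (cos _ * _); ring.
- exists (- x), th; split=> [|t]; first exact: normrN.
  by rewrite /osc normrN powN (negbTE nO) expr0 mul1r mulrN mulNr.
Qed.

Lemma osc_integral_split (R : realType) (n : nat) (a x th x' th' u v : R) :
  -1 < a -> 0 <= u -> 0 <= v ->
  (forall t, osc n a x th (- t) = osc n a x' th' t) ->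
  (\int[lebesgue_measure]_(t in `[(- u), v]) osc n a x th t =
   \int[lebesgue_measure]_(t in `[0, u]) osc n a x' th' t +
   \int[lebesgue_measure]_(t in `[0, v]) osc n a x th t)%R.
Proof.
move=> a1 u0 v0 refl.
have := @Rintegral_itvB R (osc n a x th) (BLeft (- u)) (BRight v) 0
  (osc_integrable n x th (- u) v a1).
rewrite !bnd_simp oppr_le0 u0 v0 => /(_ isT isT).
rewrite Rintegral_itv_obnd_cbnd; last first.
  apply: integrableS (osc_integrable n x th 0 v a1) => //.
  exact: subset_itv_oc_cc.
move=> <-; rewrite addrC; rewrite -[LHS](subrK
  (\int[lebesgue_measure]_(t in `[(- u), 0]) osc n a x th t)%R); congr (_ + _).
rewrite /Rintegral integral_reflect; last first.
  by apply/measurable_EFinP; exact: osc_measurable.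
by congr (fine _); apply: eq_integral => t _; congr (EFin _); exact: refl.
Qed.

(** * The whole line and the complex integral *)

Lemma line_le (R : realType) (n : nat) (a : R) : -1 < a -> a < n.+1%:R ->
  exists2 K : R, 0 < K & forall x th : R, exists2 l : R,
    (\int[lebesgue_measure]_(t in `[(- r.1), r.2]) osc n a x th t)%R
      @[r --> (+oo%R, +oo%R)] --> l &
    `|l| <= K * (1 + `|x|) `^ decay_rate n a.
Proof.
move=> a1 an; have [K K0 halfP] := half_line_le a1 an.
exists (2 * K); first by rewrite mulr_gt0.
move=> x th.
have [x' [th' [xE refl]]] := osc_reflect n a x th.
have [l cvgl l_le] := halfP x th _ (osc_primitive_integral n x th a1)
  (fun s => @osc_integral_le R n a x th s a1).
have [l' cvgl' l'_le] := halfP x' th' _ (osc_primitive_integral n x' th' a1)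
  (fun s => @osc_integral_le R n a x' th' s a1).
exists (l' + l); last first.
  rewrite xE in l'_le; apply: (le_trans (ler_normD _ _)).
  by rewrite -mulrA; lra.
pose F y ph A := (\int[lebesgue_measure]_(t in `[0, A]) osc n a y ph t)%R.
have cvg1 : (fun r : R * R => F x' th' r.1) @ (+oo%R, +oo%R) --> l'.
  exact: (cvg_comp fst (F x' th') cvg_fst cvgl').
have cvg2 : (fun r : R * R => F x th r.2) @ (+oo%R, +oo%R) --> l.
  exact: (cvg_comp snd (F x th) cvg_snd cvgl).
apply: cvg_trans (cvgD cvg1 cvg2); apply: near_eq_cvg.
near=> r; rewrite /= (osc_integral_split a1 _ _ refl) //.
- near: r; exists ([set t : R | 0 <= t], setT) => /=.
    by split; [exact: nbhs_pinfty_ge | exact: filterT].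
  by move=> r [].
- near: r; exists (setT, [set t : R | 0 <= t]) => /=.
    by split; [exact: filterT | exact: nbhs_pinfty_ge].
  by move=> r [].
Unshelve. all: by end_near. Qed.

Lemma normc_le_abs (R : realType) (u v : R) :
  `|u +i* v| <= (`|u| + `|v|)%:C.
Proof.
rewrite normc_def lecR /= -[leRHS]ger0_norm ?addr_ge0 // -sqrtr_sqr.
rewrite ler_sqrt ?sqr_ge0 // -[u ^+ 2]real_normK ?num_real //.
rewrite -[v ^+ 2]real_normK ?num_real // sqrrD -addrA lerD2l lerDr.
by rewrite mulrn_wge0 // mulr_ge0.
Qed.

Lemma Cplx_cvg (R : realType) (T : Type) (F : set_system T) (f g : T -> R)
    (l m : R) : Filter F -> f t @[t --> F] --> l -> g t @[t --> F] --> m ->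
  (f t +i* g t : Cplx R) @[t --> F] --> (l +i* m : Cplx R).
Proof.
move=> FF /cvgrPdist_lt fl /cvgrPdist_lt gm; apply/cvgrPdist_lt => eps eps0.
have /complex_realP[e eE] : (eps : R[i]) \is Num.real by apply: gtr0_real.
have e0 : 0 < e / 2 by rewrite divr_gt0 // -ltcR -eE.
have fl_e := fl _ e0; have gm_e := gm _ e0; near=> t.
apply: (@le_lt_trans _ _ (`|l - f t| + `|m - g t|)%:C).
  exact: normc_le_abs.
rewrite eE ltcR [ltRHS](splitr e); apply: ltrD; near: t => //.
Unshelve. all: by end_near. Qed.

(** The imaginary part is the real part with its phase shifted, because
    [cos (z - pi / 2) = sin z].  One real estimate, uniform in the shift, thus
    serves for both. *)
Lemma osc_integrandE (R : realType) (n : nat) (a x t : R) :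
  osc_integrand n.+2 a x t = osc n a x 0 t +i* osc n a x (- (pi / 2)) t.
Proof.
rewrite /osc_integrand /expi /osc addr0 cosBpihalf.
by simpc.
Qed.

Unset Implicit Arguments.
Set Strict Implicit.
Set Printing Implicit Defensive.

Theorem proposition4p2 (R : realType) (alpha : R) (b : nat) (hb : (2 <= b)%N) :
  (-1 < alpha < b%:R - 1 ->
    forall x : R, improper_cvg (osc_integrand b alpha x)) /\
  exists C : R, 0 < C /\ forall x : R,
    (-1 < alpha <= - (1 / 2) ->
      `|osc_integral b alpha x| <=
        (C * (1 + `|x|) `^ (-1 - alpha))%:C) /\
    (- (1 / 2) < alpha < b%:R - 1 ->
      `|osc_integral b alpha x| <=
        (C * (1 + `|x|) `^ (1 / (b%:R - 1) * (alpha - b%:R / 2 + 1)))%:C).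
Proof.
case: b hb => [|[|n]] // _.
have nE : n.+2%:R - 1 = n.+1%:R :> R by rewrite -[n.+2]addn1 natrD addrK.
rewrite nE.
have n1 : 1 <= n.+1%:R :> R by rewrite ler1n.
have [/andP[a1 an]|out] := boolP (-1 < alpha < n.+1%:R); last first.
  split=> [ain|]; first by case/negP: out.
  exists 1; split=> // x; split=> /andP[a1 a2]; case/negP: out; apply/andP;
    split; lra.
have [K K0 lineP] := line_le a1 an.
have main (x : R) : exists2 l : Cplx R,
    truncated_integral (osc_integrand n.+2 alpha x) r @[r --> (+oo, +oo)] --> l
    & `|l : R[i]| <= (2 * K * (1 + `|x|) `^ decay_rate n alpha)%:C.
  have [l cvgl l_le] := lineP x 0; have [m cvgm m_le] := lineP x (- (pi / 2)).
  exists (l +i* m); last first.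
    apply: (le_trans (normc_le_abs _ _)); rewrite lecR -mulrA; lra.
  pose I ph (r : R * R) :=
    (\int[lebesgue_measure]_(t in `[(- r.1), r.2]) osc n alpha x ph t)%R.
  have TE : truncated_integral (osc_integrand n.+2 alpha x) =
      (fun r => I 0 r +i* I (- (pi / 2)) r).
    apply/funext => r; rewrite /truncated_integral /Cintegral.
    by congr (_ +i* _); apply: eq_Rintegral => t _; rewrite osc_integrandE.
  rewrite TE; exact: Cplx_cvg cvgl cvgm.
have bound (x : R) : `|osc_integral n.+2 alpha x| <=
    (2 * K * (1 + `|x|) `^ decay_rate n alpha)%:C.
  have [l cvgl l_le] := main x; rewrite /osc_integral /improper_integral.
  by rewrite (cvg_lim _ cvgl) //; exact: norm_hausdorff.
split=> [_ x|]; first by have [l cvgl _] := main x; apply: cvgP cvgl.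
exists (2 * K); split; first by rewrite mulr_gt0.
move=> x; split=> /andP[al ar]; rewrite (le_trans (bound x)) // lecR.
- rewrite /decay_rate min_l // (_ : (_ / _) = -1 - alpha) //.
  by field; rewrite nat1r pnatr_eq0.
- rewrite /decay_rate min_r ?(ltW al) // (_ : (_ / n.+1%:R) =
    1 / n.+1%:R * (alpha - n.+2%:R / 2 + 1)) //.
  by field; rewrite nat1r pnatr_eq0.
Qed.
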